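(* Let $p$ be a prime. For every non-cyclic finite $p$-group $P$ there exists a finite solvable group $G$ (having $P$ as a Sylow $p$-subgroup) such that $P$ is redundant in $G$ and $\nu_p(G)=q^{p+1}$, where $q>1$ is the smallest prime power congruent to $1$ modulo $p$.
   Context: All groups are finite. For a finite group $G$ and a prime $p$, $\nu_p(G)$ denotes the number of Sylow $p$-subgroups of $G$. A $p$-element of $G$ is an element whose order is a power of $p$. A Sylow $p$-subgroup $P$ of $G$ is called redundant (in $G$) if every $p$-element of $G$ lies in a Sylow $p$-subgroup of $G$ different from $P$. To say that an abstract $p$-group $P$ is redundant in $G$ means that (an isomorphic copy of) $P$ is a Sylow $p$-subgroup of $G$ which is redundant. *)

(* Defs.v *)
From mathcomp Require Import all_boot all_fingroup all_solvable.

Set Implicit Arguments.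
Unset Strict Implicit.
Unset Printing Implicit Defensive.

Local Open Scope group_scope.

Definition prime_power (q : nat) : Prop :=
  exists r k : nat, [/\ prime r, 0 < k & q = (r ^ k)%N].

(* As k > 0 in prime_power, 1 is not a prime power, so q > 1 holds
   automatically. *)
Definition prime_power_1mod (p q : nat) : Prop :=
  prime_power q /\ q = 1 %[mod p].

Definition least_prime_power_1mod (p q : nat) : Prop :=
  prime_power_1mod p q /\
  forall q' : nat, prime_power_1mod p q' -> q <= q'.

Definition redundant (p : nat) (gT : finGroupType) (G P : {group gT}) : Prop :=
  P \in 'Syl_p(G) /\
  forall x : gT, x \in G -> p.-elt x ->
    exists Q : {group gT}, [/\ Q \in 'Syl_p(G), Q != P & x \in Q].

Definition nu (p : nat) (gT : finGroupType) (G : {group gT}) : nat :=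
  #|'Syl_p(G)|.

(* Main.v *)
Require Import Defs.
From mathcomp Require Import all_boot all_fingroup all_solvable.
From mathcomp Require Import all_algebra all_field.

(** Let F be the field of order q, so that the cyclic group F^* has an element
w of order p, and let V = F^(p+1). Being non-cyclic, P has a normal subgroup N
with P / N elementary abelian of order p^2. The p + 1 lines of P / N pull back
to p + 1 subgroups of index p in P; each is the kernel of a linear character
chi_i : P -> <w>, and together they cover P, since every element of P / N lies
on some line ([covering_lin_chars]).

Let P act on V diagonally, through chi_i on the i-th coordinate, and take
G = V ><| P. As no chi_i is trivial, no nonzero vector is fixed by all of P;
as V has order prime to p, this makes P self-normalising in G, so that P has
|V| = q^(p+1) conjugates. As the kernels cover P, every x in P fixes some
nonzero vector v, whence x = x ^ v lies in P :^ v, which differs from P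
because v does not normalise P. A p-element outside P lies in some Sylow
subgroup, necessarily different from P. So P is redundant
([sylow_count_redundant], [redundant_diag_sdprod]). *)

Set Implicit Arguments.
Unset Strict Implicit.
Unset Printing Implicit Defensive.

Local Open Scope group_scope.

(** * Sylow subgroups of a coprime semidirect product *)

(** The coprime action gives 'N_V(P) = 'C_V(P) = 1, so P is self-normalising and
its conjugates are exactly the P :^ v with v in V, all distinct. An element x
of P is caught by P :^ v for any v != 1 in V commuting with x. *)
Lemma sylow_count_redundant (gT : finGroupType) (p : nat) (G V P : {group gT}) :
    V ><| P = G -> p.-group P -> p^'.-group V -> 'C_V(P) = 1 ->
    {in P, forall x, 'C_V[x] != 1} ->
  redundant p G P /\ nu p G = #|V|.
Proof.
move=> defG pP p'V regPV cV1.
have [_ /= defVP nVP _] := sdprodP defG.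
have sylP : p.-Sylow(G) P.
  have := mulG_subr V P; rewrite defVP => sPG.
  rewrite pHallE sPG -(sdprod_card defG) /=.
  by rewrite partnM ?cardG_gt0 // part_p'nat // part_pnat_id // mul1n.
have NVP : 'N_V(P) = 1.
  by rewrite coprime_norm_cent // coprime_sym (pnat_coprime pP p'V).
have NGP : 'N_G(P) = P.
  by rewrite -defVP setIC -group_modr ?normG // setIC NVP mul1g.
split; last first.
  rewrite /nu (card_Syl sylP) NGP; apply/eqP.
  by rewrite -(eqn_pmul2l (cardG_gt0 P)) Lagrange ?(pHall_sub sylP) //
             mulnC (sdprod_card defG).
split=> [|x Gx px]; first by rewrite inE.
have [Px|nPx] := boolP (x \in P); last first.
  have [|g Gg] := Sylow_subJ sylP _ px; first by rewrite cycle_subG.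
  rewrite cycle_subG => Pgx; exists (P :^ g)%G.
  split=> //; first by rewrite inE pHallJ.
  by apply: contraNneq nPx => <-.
have /trivgPn[v /setIP[Vv cxv] v1] := cV1 x Px.
exists (P :^ v)%G; split.
- by rewrite inE pHallJ // -defVP (subsetP (mulG_subl P V)).
- apply: contra v1 => /eqP/(congr1 val) /= nPv.
  by rewrite -in_set1 -[[set 1]]/(1%g : {set gT}) -NVP inE Vv inE nPv /=.
- by rewrite mem_conjg conjgE invgK mulgA (cent1P cxv) mulgK.
Qed.

(** * Diagonal actions on row vectors *)

Section DiagonalAction.

Variables (F : finFieldType) (gT : finGroupType) (P : {group gT}) (n : nat).
Variable chi : 'I_n -> {morphism P >-> {unit F}}.

Definition diag_act (v : 'rV[F]_n) (x : gT) : 'rV[F]_n :=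
  (\row_i (v ord0 i * FinRing.uval (chi i x)))%R.

Lemma diag_act_is_action : is_action P diag_act.
Proof.
split=> [x u v /rowP eq_uv | v x y Px Py]; apply/rowP=> i.
  by have := eq_uv i; rewrite !mxE => /(GRing.mulIr (valP (chi i x))).
by rewrite !mxE morphM // GRing.mulrA.
Qed.

Canonical diag_action := Action diag_act_is_action.

Lemma diag_act_is_groupAction : is_groupAction [set: 'rV[F]_n] diag_action.
Proof.
move=> x Px; rewrite inE; apply/andP; split.
  by apply/subsetP=> v _; rewrite inE.
apply/morphicP=> u v _ _; rewrite !actpermE; apply/rowP=> i.
by rewrite !mxE GRing.mulrDl.
Qed.

Canonical diag_groupAction := GroupAction diag_act_is_groupAction.

End DiagonalAction.

(** Redundancy of P in F^n ><| P: a vector fixed by P vanishes in each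
coordinate i, since some value of chi i differs from 1; and an x killed by chi i
fixes the i-th basis vector. *)
Lemma redundant_diag_sdprod (F : finFieldType) (gT : finGroupType)
    (P : {group gT}) (p n : nat) (chi : 'I_n -> {morphism P >-> {unit F}}) :
    p.-group P -> p^'.-nat #|F| ->
    (forall i, exists2 x, x \in P & chi i x != 1) ->
    {in P, forall x, exists i, chi i x = 1} ->
  exists (rT : finGroupType) (G S : {group rT}),
    [/\ solvable G, P \isog S, redundant p G S & nu p G = (#|F| ^ n)%N].
Proof.
move=> pP p'F chi_neq1 chi_cover.
pose to := diag_groupAction chi.
have inj1 := injm_sdpair1 to; have inj2 := injm_sdpair2 to.
pose V := (sdpair1 to @* [set: 'rV[F]_n])%G; pose S := (sdpair2 to @* P)%G.
pose G := [set: sdprod_groupType to]%G.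
have defG : V ><| S = G := sdprod_sdpair to.
have isoPS : P \isog S by rewrite (sub_isog (subxx P) inj2).
have cardV : #|V| = (#|F| ^ n)%N.
  by rewrite card_injm ?subsetT // cardsT card_mx mul1n.
have actE (v : 'rV[F]_n) x : x \in P ->
    sdpair1 to (diag_act chi v x) = sdpair1 to v ^ sdpair2 to x.
  by move=> Px; rewrite -sdpair_act ?inE.
have memV (v : 'rV[F]_n) : sdpair1 to v \in V by rewrite mem_morphim ?inE.
have [] // := @sylow_count_redundant _ p [set: sdprod_groupType to]%G V S defG.
- by rewrite -(isog_pgroup _ isoPS).
- by rewrite /pgroup cardV pnatX p'F.
- apply/trivgP/subsetP=> _ /setIP[/morphimP[v _ _ ->] /centP cPv].
  suffices ->: v = 1 by rewrite morph1 inE.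
  apply/rowP=> i; have [x Px chi_x] := chi_neq1 i.
  have : sdpair1 to (diag_act chi v x) = sdpair1 to v.
    by rewrite actE // conjgE (cPv _ (mem_morphim _ Px Px)) mulKg.
  move/(injmP inj1 _ _ (in_setT _) (in_setT _))/rowP/(_ i).
  rewrite !mxE => /eqP.
  rewrite -GRing.subr_eq0 -{2}[v _ i]GRing.mulr1 -GRing.mulrBr GRing.mulf_eq0.
  rewrite GRing.subr_eq0 orbC => /orP[/eqP e | /eqP//].
  by case/eqP: chi_x; apply: val_inj.
- move=> _ /morphimP[x _ Px ->]; have [i chi_x] := chi_cover x Px.
  apply/trivgPn; exists (sdpair1 to (delta_mx ord0 i)).
    rewrite inE memV; apply/cent1P/commgP/conjg_fixP.
    rewrite -actE //; congr (sdpair1 to _).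
    apply/rowP=> j; rewrite !mxE eqxx /=.
    by case: eqP => [->|_]; rewrite ?chi_x ?GRing.mulr1 ?GRing.mul0r.
  rewrite morph_injm_eq1 ?inE //; apply/eqP=> /rowP/(_ i)/eqP.
  by rewrite !mxE !eqxx GRing.oner_eq0.
move=> redS nuG; exists (sdprod_groupType to), [set: sdprod_groupType to]%G, S.
split=> //; last by rewrite nuG.
have [nVG _ _ _ _] := sdprod_context defG.
rewrite (series_sol nVG) -(isog_sol (sdprod_isog defG)) -(isog_sol isoPS).
by rewrite (pgroup_sol pP) morphim_sol // abelian_sol // FinRing.zmod_abelian.
Qed.

(** * Covering a non-cyclic p-group by kernels of linear characters *)

(** By the Burnside basis theorem the elementary abelian group P / 'Phi(P) has
rank at least 2; a further quotient by a subgroup of corank 2 brings the rank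
down to exactly 2. *)
Lemma quotient_p2Elem (gT : finGroupType) (p : nat) (P : {group gT}) :
    p.-group P -> ~~ cyclic P ->
  exists2 N : {group gT}, N <| P & (P / N)%G \in 'E_p^2(P / N).
Proof.
move=> pP ncycP; have nPhi := Phi_normal P.
have abE := Phi_quotient_abelem pP.
have rE2 : 1 < 'r_p(P / 'Phi(P)).
  rewrite ltnNge; apply: contra ncycP => rE1.
  by apply: Phi_quotient_cyclic; rewrite (abelem_cyclic abE) -p_rank_abelem.
have /p_rank_geP[C] : 'r_p(P / 'Phi(P)) - 2 <= 'r_p(P / 'Phi(P)).
  exact: leq_subr.
case/pnElemP=> sCE _ rC.
have nCE : C <| P / 'Phi(P).
  by rewrite -sub_abelian_normal ?(abelem_abelian abE).
have [N defC sPhiN nNP] := inv_quotientN nPhi nCE.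
exists N => //; apply/pnElemP.
have isoN : P / 'Phi(P) / C \isog P / N by rewrite defC third_isog.
split=> //; first by rewrite -(isog_abelem isoN) quotient_abelem.
rewrite -(card_isog isoN) card_quotient ?normal_norm // -divgS //.
by rewrite logn_div ?cardSg // rC -p_rank_abelem // subKn.
Qed.

Lemma lin_char_ker (gT uT : finGroupType) (p : nat) (P M : {group gT})
    (w : uT) :
    prime p -> M <| P -> #|P : M| = p -> #[w] = p ->
  exists chi : {morphism P >-> uT}, 'ker chi = M.
Proof.
move=> p_pr nMP indM ow; have nMP' := normal_norm nMP.
have oPM : #|P / M| = p by rewrite card_quotient.
have : (P / M) \isog <[w]>.
  have cycPM : cyclic (P / M) by rewrite prime_cyclic ?oPM.
  by rewrite isog_cyclic_card // cycle_cyclic -orderE ow oPM /=.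
case/isogP=> f injf _.
have sPf : P \subset coset M @*^-1 (P / M) by rewrite -sub_quotient_pre.
exists [morphism of restrm sPf (f \o coset M)].
rewrite ker_restrm ker_comp (trivgP injf).
by rewrite -[_ @*^-1 1]/('ker _) ker_coset (setIidPr (normal_sub nMP)).
Qed.

(** The characters correspond to the lines of a quotient P / N of order p^2 and
exponent p: there are p + 1 lines, and each element of P / N lies on one. *)
Lemma covering_lin_chars (gT uT : finGroupType) (p : nat) (P : {group gT})
    (w : uT) :
    prime p -> p.-group P -> ~~ cyclic P -> #[w] = p ->
  exists chi : 'I_p.+1 -> {morphism P >-> uT},
    (forall i, exists2 x, x \in P & chi i x != 1) /\
    {in P, forall x, exists i, chi i x = 1}.
Proof.
move=> p_pr pP ncycP ow; have [N nNP E2] := quotient_p2Elem pP ncycP.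
have [_ abE oE] := pnElemPcard E2.
have cL := card_p1Elem_p2Elem E2.
have chiP (i : 'I_p.+1) : exists chi : {morphism P >-> uT},
    'ker chi == (coset N @*^-1 (enum_val (cast_ord (esym cL) i)))%G :> {set _}.
  have /pnElemPcard[] := enum_valP (cast_ord (esym cL) i).
  set L := enum_val _ => sLE _ oL.
  have [||chi kerchi] := lin_char_ker p_pr _ _ ow
    (P := P) (M := coset N @*^-1 L).
  - rewrite -(quotientGK nNP) cosetpre_normal -sub_abelian_normal //.
    exact: abelem_abelian abE.
  - rewrite -(quotientGK nNP) index_cosetpre.
    by rewrite -divgS // oE oL expnS mulnK ?prime_gt0.
  - by exists chi; apply/eqP.
have [chi kerchi] := fin_all_exists chiP.
exists chi; split=> [i|x Px].
  suffices: ~~ (P \subset 'ker (chi i)).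
    by case/subsetPn=> x Px; rewrite !inE Px => chi_x; exists x.
  rewrite (eqP (kerchi i)) -sub_quotient_pre ?normal_norm //.
  have /pnElemPcard[_ _ oL] := enum_valP (cast_ord (esym cL) i).
  by apply/negP=> /subset_leq_card; rewrite oE oL leq_exp2l // prime_gt1.
have [L E1L Lx] : exists2 L, L \in 'E_p^1(P / N) & coset N x \in L.
  have Ex : coset N x \in P / N by rewrite mem_quotient.
  have [x1 | x1] := eqVneq (coset N x) 1.
    have /card_gt0P[L E1L] : 0 < #|'E_p^1(P / N)| by rewrite cL.
    by exists L; rewrite // x1 group1.
  exists <[coset N x]>%G; last exact: cycle_id.
  have ox := abelem_order_p abE Ex x1.
  by rewrite p1ElemE // !inE cycle_subG Ex -orderE ox /=.
exists (cast_ord cL (enum_rank_in E1L L)).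
apply/(kerP _ Px); rewrite (eqP (kerchi _)) cast_ordK enum_rankK_in //.
by rewrite mem_morphpre // (subsetP (normal_norm nNP)).
Qed.

Theorem theorem2 (p q : nat) (p_pr : prime p)
    (q_least : least_prime_power_1mod p q)
    (gT : finGroupType) (P : {group gT}) (pP : p.-group P)
    (ncycP : ~~ cyclic P) :
  exists (rT : finGroupType) (G S : {group rT}),
    [/\ solvable G, P \isog S, redundant p G S & nu p G = (q ^ p.+1)%N].
Proof.
have [[[r [k [r_pr k_gt0 def_q]]] q1p] _] := q_least.
have [F _ oF] := pPrimePowerField r_pr k_gt0.
rewrite -def_q in oF; have q_gt0 : 0 < q by rewrite def_q expn_gt0 prime_gt0.
have p_dv : p %| q.-1 by rewrite -subn1 -eqn_mod_dvd ?q1p.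
have p'q : p^'.-nat q.
  rewrite p'natE // -(prednK q_gt0) -addn1 dvdn_addr // dvdn1.
  by rewrite neq_ltn (prime_gt1 p_pr) orbT.
have [w _ ow] : {w : {unit F} | w \in [set: {unit F}] & #[w] = p}.
  by apply: Cauchy => //; rewrite card_finField_unit oF.
have [chi [chi_neq1 chi_cover]] := covering_lin_chars p_pr pP ncycP ow.
rewrite -oF; apply: redundant_diag_sdprod chi_neq1 chi_cover => //.
by rewrite oF.
Qed.
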